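(* Let $\mathfrak{g}$ be a real semisimple Lie algebra. Every $\mathbb{H}$-representation $(\rho,J)$ of $\mathfrak{g}$ decomposes as a direct sum of irreducible $\mathbb{H}$-representations.
   Context: An $\mathbb{H}$-representation of $\mathfrak{g}$ is an $\mathbb{R}$-linear Lie algebra homomorphism $\mathfrak{g}\to\mathrm{End}_{\mathbb{H}}(W)$ for a finite dimensional (right) quaternionic vector space $W$. Equivalently it is a pair $(\rho,J)$ where $\rho:\mathfrak{g}\to\mathrm{End}_{\mathbb{C}}(V)$ is an $\mathbb{R}$-linear Lie algebra homomorphism on a finite dimensional complex vector space $V$ and $J:V\to V$ is a $\rho$-equivariant antilinear map with $J^2=-1$ ($V$ is $W$ with scalars restricted to $\mathbb{C}$ and $J$ is multiplication by $j\in\mathbb{H}$). A subrepresentation is a $\rho$-invariant, $J$-invariant complex subspace (i.e. an invariant quaternionic subspace). An $\mathbb{H}$-representation is irreducible if it is non-zero and has no non-zero proper $\mathbb{H}$-subrepresentation. *)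

(* Defs.v *)
From HB Require Import structures.
From mathcomp Require Import all_boot all_order all_algebra.
From mathcomp Require Import complex.
From mathcomp Require Import reals.

Set Implicit Arguments.
Unset Strict Implicit.
Unset Printing Implicit Defensive.

Import Order.TTheory GRing.Theory Num.Theory.

Local Open Scope ring_scope.

HB.mixin Record Vector_isLie (F : fieldType) L of Vector F L := {
  lieb : L -> L -> L;
  liebDl : forall x y z, lieb (x + y) z = lieb x z + lieb y z;
  liebDr : forall x y z, lieb x (y + z) = lieb x y + lieb x z;
  liebZl : forall a x y, lieb (a *: x) y = a *: lieb x y;
  liebZr : forall a x y, lieb x (a *: y) = a *: lieb x y;
  liebxx : forall x, lieb x x = 0;
  lieb_jacobi : forall x y z,
    lieb x (lieb y z) + lieb y (lieb z x) + lieb z (lieb x y) = 0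
}.

#[short(type="lieAlgType")]
HB.structure Definition LieAlgebra (F : fieldType) :=
  { L of Vector_isLie F L & Vector F L }.

Section Semisimple.
Variables (F : fieldType) (g : lieAlgType F).
Implicit Types A B C I : {vspace g}.

Definition lie_ideal I : Prop :=
  forall x y : g, y \in I -> lieb x y \in I.

(* By bilinearity, brackets of basis vectors already span the subspace
   generated by all brackets of elements of A and B; see [lie_prod_subP]. *)
Definition lie_prod A B : {vspace g} :=
  <<[seq lieb x y | x <- vbasis A, y <- vbasis B]>>%VS.

Lemma memv_lie_prod A B x y : x \in A -> y \in B -> lieb x y \in lie_prod A B.
Proof.
have bl0 (z : g) : lieb 0 z = 0 by have := liebZl 0 0 z; rewrite !scale0r.
have br0 (z : g) : lieb z 0 = 0 by have := liebZr 0 z 0; rewrite !scale0r.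
move=> xA yB; rewrite (coord_vbasis xA) (coord_vbasis yB).
rewrite (big_morph (lieb^~ _) (fun a b => liebDl a b _) (bl0 _)).
apply: memv_suml => i _; rewrite liebZl; apply: memvZ.
rewrite (big_morph (lieb _) (liebDr _) (br0 _)).
apply: memv_suml => j _; rewrite liebZr; apply: memvZ.
by apply: memv_span; apply: allpairs_f; rewrite mem_nth ?size_tuple.
Qed.

Lemma lie_prod_subP A B C :
  (forall x y, x \in A -> y \in B -> lieb x y \in C) <->
  (lie_prod A B <= C)%VS.
Proof.
split=> [abC | /subvP sC x y xA yB]; last exact/sC/memv_lie_prod.
apply/span_subvP => _ /allpairsP[[x y] [/= xA yB ->]].
by apply: abC; apply: vbasis_mem.
Qed.

Definition lie_derived (n : nat) I : {vspace g} :=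
  iter n (fun A => lie_prod A A) I.

Definition lie_solvable I : Prop := exists n, lie_derived n I = 0%VS.

(* That is, the radical (largest solvable ideal) is zero. *)
Definition lie_semisimple : Prop :=
  forall I, lie_ideal I -> lie_solvable I -> I = 0%VS.

End Semisimple.

(** Quaternionic representations of a real Lie algebra [g], as pairs (rho, J)
    on a finite-dimensional complex vector space [V]. *)

Section HRep.
Variables (R : realType) (g : lieAlgType R).

(* The scaling laws after the bar make [hrep_rho] R-linear, for the real
   structure underlying 'End(V), and [hrep_J] antilinear. *)
Record hrep (V : vectType R[i]) := HRep {
  hrep_rho : {linear g -> 'End(V) | real_complex R \; *:%R};
  hrep_J : {linear V -> V | (@Num.conj R[i]) \; *:%R};
  hrep_lieb : forall x y : g, hrep_rho (lieb x y) =
    (hrep_rho x \o hrep_rho y)%VF - (hrep_rho y \o hrep_rho x)%VF;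
  hrep_JJ : forall v : V, hrep_J (hrep_J v) = - v;
  hrep_equiv : forall (x : g) (v : V),
    hrep_J (hrep_rho x v) = hrep_rho x (hrep_J v)
}.

Definition subhrep (V : vectType R[i]) (r : hrep V) (U : {vspace V}) : Prop :=
  (forall (x : g) (v : V), v \in U -> hrep_rho r x v \in U) /\
  (forall v : V, v \in U -> hrep_J r v \in U).

Definition hrep_irreducible (V : vectType R[i]) (r : hrep V) : Prop :=
  fullv != 0%VS :> {vspace V} /\
  forall U : {vspace V}, subhrep r U -> U = 0%VS \/ U = fullv.

Section Restriction.
Variables (V : vectType R[i]) (r : hrep V) (U : {vspace V}).

Definition res_rho (x : g) : 'End(subvs_of U) :=
  linfun (vsproj U \o (hrep_rho r x \o vsval)).

Definition res_J (u : subvs_of U) : subvs_of U := vsproj U (hrep_J r (vsval u)).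

Fact res_rho_linear : linear_for (real_complex R \; *:%R) res_rho.
Proof.
move=> a x y; apply/lfunP => u.
by rewrite !lfun_simp /= linearP !lfun_simp linearP.
Qed.
HB.instance Definition _ := GRing.isLinear.Build R g 'End(subvs_of U)
  (real_complex R \; *:%R) res_rho res_rho_linear.

Fact res_J_linear : linear_for ((@Num.conj R[i]) \; *:%R) res_J.
Proof. by move=> a u v; rewrite /res_J !linearP. Qed.
HB.instance Definition _ := GRing.isLinear.Build R[i] (subvs_of U) (subvs_of U)
  ((@Num.conj R[i]) \; *:%R) res_J res_J_linear.

Hypothesis subU : subhrep r U.

Lemma val_res_rho x u : vsval (res_rho x u) = hrep_rho r x (vsval u).
Proof. by rewrite lfunE /= vsprojK // subU.1 // subvsP. Qed.

Lemma val_res_J u : vsval (res_J u) = hrep_J r (vsval u).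
Proof. by rewrite /res_J vsprojK // subU.2 // subvsP. Qed.

Fact res_lieb x y : res_rho (lieb x y) =
  (res_rho x \o res_rho y)%VF - (res_rho y \o res_rho x)%VF.
Proof.
apply/lfunP => u; apply: val_inj => /=.
rewrite add_lfunE opp_lfunE !comp_lfunE linearB /= !val_res_rho hrep_lieb.
by rewrite !lfun_simp.
Qed.

Fact res_JJ u : res_J (res_J u) = - u.
Proof. by apply: val_inj; rewrite /= !val_res_J hrep_JJ. Qed.

Fact res_equiv x u : res_J (res_rho x u) = res_rho x (res_J u).
Proof.
by apply: val_inj; rewrite /= val_res_J !val_res_rho val_res_J hrep_equiv.
Qed.

Definition hrep_res : hrep (subvs_of U) :=
  @HRep (subvs_of U) res_rho res_J res_lieb res_JJ res_equiv.

End Restriction.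

End HRep.

(* Main.v *)
From HB Require Import structures.
Require Import Defs.
From mathcomp Require Import all_boot all_order all_algebra.
From mathcomp Require Import complex.
From mathcomp Require Import reals.
From mathcomp Require Import boolp.

Set Implicit Arguments.
Unset Strict Implicit.
Unset Printing Implicit Defensive.

Import Order.TTheory GRing.Theory Num.Theory passmx.
Local Open Scope ring_scope.

(** Complete reducibility follows once every invariant quaternionic subspace U
    has an invariant complement, because one can then split off minimal invariant
    subspaces one at a time ([subhrep_decomposition]).  Averaging over J reduces
    the complement to an equivariant complex projection onto U
    ([hrep_complement]).  The obstruction to making a given projection
    equivariant is a 1-cocycle of g with values in a finite-dimensional complex
    representation, so everything rests on Whitehead's lemma: such a cocycle is a
    coboundary ([cocycle_is_coboundary]).

    For Whitehead's lemma, let sigma be the representation and K its kernel.  The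
    cocycle vanishes on K because ideals of g are perfect, and the real part of
    the trace form of sigma is nondegenerate on the Killing orthogonal N of K.
    The Casimir operator Om built from dual bases of N commutes with sigma, has
    trace of real part dim N, and turns the cocycle into a coboundary.  By
    Fitting's lemma the cocycle is therefore cohomologous to one with values in
    the kernel of a power of Om, which is a proper subspace, and one concludes by
    induction on the dimension ([cocycle_reduction]).

    The structure of g comes from Cartan's criterion ([trace_form_nilpotent]): an
    ideal I orthogonal to g for a trace form acts nilpotently through [g, I].
    Its proof exhibits, for a complex matrix X, the matrix Y acting on the
    generalized eigenspaces of X by the conjugate eigenvalues, and recovers
    ad Y as a polynomial in ad X without constant term; then
    tr (X Y) = 0 forces all eigenvalues of X to vanish ([nilpotent_criterion]).
    With Engel's theorem for the adjoint representation ([engel]) and the absence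
    of abelian ideals, this shows that the Killing form is nondegenerate; hence
    every ideal is a direct summand and is perfect. *)

(** * Polynomials with prescribed jets, and polynomials in an operator *)

Lemma coprimep_XsubC_prod (F : fieldType) (rs : seq F) (m : nat) (a : F) :
  a \notin rs ->
  coprimep (('X - a%:P) ^+ m) (\prod_(b <- rs) ('X - b%:P) ^+ m).
Proof.
move=> a_rs; rewrite coprimep_expl // coprimep_sym coprimep_XsubC rootE.
rewrite horner_prod prodf_seq_neq0; apply/allP => b b_rs /=.
rewrite horner_exp hornerXsubC expf_eq0 subr_eq0 negb_and; apply/orP; right.
by apply: contraNneq a_rs => ->.
Qed.

(** Chinese remainder theorem: one more point a is handled by a multiple of the
    product w of the previous moduli, which is invertible modulo (X - a)^m. *)
Lemma poly_interpolation (F : fieldType) (rs : seq F) (m : nat) (f : F -> F) :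
  exists u : {poly F},
    forall a, a \in rs -> (('X - a%:P) ^+ m %| u - (f a)%:P)%R.
Proof.
elim: rs => [|a rs [u hu]]; first by exists 0.
have [a_rs|a_rs] := boolP (a \in rs).
  by exists u => b; rewrite inE => /predU1P[->|]; apply: hu.
pose w := \prod_(b <- rs) ('X - b%:P) ^+ m.
have cop : coprimep (('X - a%:P) ^+ m) w.
  by rewrite coprimep_XsubC_prod.
have /Bezout_eq1_coprimepP[[s t] /= st] := cop.
exists (u + t * w * ((f a)%:P - u)) => b; rewrite inE => /predU1P[->|b_rs].
  have -> : u + t * w * ((f a)%:P - u) - (f a)%:P
    = (s * ('X - a%:P) ^+ m) * (u - (f a)%:P).
    rewrite -[s * _](addrK (t * w)) st mulrBl mul1r addrAC.
    by rewrite -[_%:P - u]opprB mulrN.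
  by rewrite mulrAC dvdp_mulIr.
rewrite addrAC dvdp_addr ?hu // -mulrA mulrCA dvdp_mulr //.
by rewrite /w (big_rem b) //= dvdp_mulr.
Qed.

Lemma dvdp_prod_XsubC_exp (F : fieldType) (rs : seq F) (m : nat) (p : {poly F}) :
  uniq rs -> (forall a, a \in rs -> ('X - a%:P) ^+ m %| p) ->
  \prod_(a <- rs) ('X - a%:P) ^+ m %| p.
Proof.
elim: rs => [|a rs IH] /=; first by rewrite big_nil dvd1p.
move=> /andP[a_rs urs] H; rewrite big_cons Gauss_dvdp; last first.
  exact: coprimep_XsubC_prod.
rewrite H ?mem_head //= IH // => b b_rs.
by apply: H; rewrite inE b_rs orbT.
Qed.

Section PolyAction.
Variables (F : fieldType) (W : lmodType F) (D : {linear W -> W}).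
Implicit Types (p q : {poly F}) (Z : W).

(** This is p(D) applied to Z; it lets polynomials act through ad X, an operator
    on matrices, without encoding that operator as a matrix itself. *)
Definition poly_act p Z := \sum_(i < size p) p`_i *: iter i D Z.

Lemma poly_act_widen N p Z : (size p <= N)%N ->
  poly_act p Z = \sum_(i < N) p`_i *: iter i D Z.
Proof.
move=> le; rewrite /poly_act (big_ord_widen N (fun i => p`_i *: iter i D Z)) //.
rewrite big_mkcond /=; apply: eq_bigr => i _.
by case: ltnP => // /leq_sizeP -> //; rewrite scale0r.
Qed.

Lemma poly_actD p q Z : poly_act (p + q) Z = poly_act p Z + poly_act q Z.
Proof.
pose N := maxn (size p) (size q).
rewrite !(@poly_act_widen N) ?leq_maxl ?leq_maxr ?size_polyD // -big_split /=.
by apply: eq_bigr => i _; rewrite coefD scalerDl.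
Qed.

Lemma poly_actC c Z : poly_act c%:P Z = c *: Z.
Proof.
by rewrite (@poly_act_widen 1) ?size_polyC ?leq_b1 // big_ord1 coefC.
Qed.

Lemma poly_actCM c p Z : poly_act (c%:P * p) Z = c *: poly_act p Z.
Proof.
rewrite mul_polyC (@poly_act_widen (size p)) ?size_scale_leq // scaler_sumr.
by apply: eq_bigr => i _; rewrite coefZ scalerA.
Qed.

Lemma poly_act0 p : poly_act p 0 = 0.
Proof.
have D0 k : iter k D 0 = 0 by elim: k => //= k ->; apply: linear0.
by rewrite /poly_act big1 // => i _; rewrite D0 scaler0.
Qed.

Lemma poly_actMX p Z : poly_act (p * 'X) Z = poly_act p (D Z).
Proof.
rewrite (@poly_act_widen (size p).+1); last first.
  by rewrite (leq_trans (size_polyMleq _ _)) // size_polyX addn2.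
rewrite big_ord_recl coefMX scale0r add0r; apply: eq_bigr => i _.
by rewrite coefMX /= -iterS iterSr.
Qed.

Lemma poly_act_comm p Z : poly_act p (D Z) = D (poly_act p Z).
Proof.
by rewrite linear_sum; apply: eq_bigr => i _; rewrite linearZ /= -iterS iterSr.
Qed.

Lemma poly_actM p q Z : poly_act (p * q) Z = poly_act p (poly_act q Z).
Proof.
elim/poly_ind: p Z => [|p c IH] Z.
  by rewrite mul0r /poly_act !size_poly0 !big_ord0.
rewrite mulrDl mulrAC !poly_actD poly_actCM poly_actC !poly_actMX.
by rewrite IH poly_act_comm.
Qed.

Lemma poly_act_sum I (s : seq I) (G : I -> W) p :
  poly_act p (\sum_(i <- s) G i) = \sum_(i <- s) poly_act p (G i).
Proof.
rewrite exchange_big /=; apply: eq_bigr => i _; rewrite -scaler_sumr.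
congr (_ *: _); elim: (nat_of_ord i) => //= k ->.
by rewrite linear_sum.
Qed.

Lemma poly_actXsubC_exp c k Z :
  poly_act (('X - c%:P) ^+ k) Z = iter k (fun Z => D Z - c *: Z) Z.
Proof.
elim: k Z => [|k IH] Z; first by rewrite expr0 -polyC1 poly_actC scale1r.
rewrite exprSr poly_actM IH iterSr -polyCN poly_actD poly_actC scaleNr.
by rewrite -['X]mul1r poly_actMX -polyC1 poly_actC scale1r.
Qed.

End PolyAction.

(** Each application of Z -> M Z - Z N adds one factor M on the left or N on the
    right, so after a + b steps every term contains M^a or N^b. *)
Lemma iter_ad_nilpotent (K : pzRingType) (a b : nat) (M N Z : K) :
  M ^+ a * Z = 0 -> Z * N ^+ b = 0 ->
  iter (a + b) (fun Z => M * Z - Z * N) Z = 0.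
Proof.
move=> MZ ZN; pose ad Y := M * Y - Y * N.
suff H k i j : (a + b <= i + j + k)%N -> M ^+ i * iter k ad Z * N ^+ j = 0.
  by have := H (a + b)%N 0%N 0%N (leqnn _); rewrite !expr0 mul1r mulr1.
elim: k i j => [|k IH] i j /=.
  rewrite addn0 => le.
  have [ai|ia] := leqP a i.
    by rewrite -(subnK ai) exprD -(mulrA (M ^+ _)) MZ mulr0 mul0r.
  have bj : (b <= j)%N by rewrite -(leq_add2l a) (leq_trans le) // leq_add2r ltnW.
  by rewrite -(subnKC bj) exprD mulrA -(mulrA _ Z) ZN mulr0 mul0r.
move=> le; rewrite mulrBr mulrBl !mulrA -exprSr -!mulrA -exprS !mulrA !IH ?subrr //.
  by rewrite addnS addSn -addnS.
by rewrite !addSn -addnS.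
Qed.

(** * Triangular and nilpotent matrices *)

Section Triangular.
Variable F : fieldType.

Lemma trig_mulmx n (A B : 'M[F]_n) : is_trig_mx A -> is_trig_mx B ->
  is_trig_mx (A *m B) /\ forall i, (A *m B) i i = A i i * B i i.
Proof.
move=> /is_trig_mxP tA /is_trig_mxP tB; split.
  apply/is_trig_mxP => i j ij; rewrite mxE big1 // => k _.
  have [ik|ki] := ltnP i k; first by rewrite tA // mul0r.
  by rewrite tB ?mulr0 // (leq_ltn_trans ki).
move=> i; rewrite mxE (bigD1 i) //= big1 ?addr0 // => k.
rewrite neq_ltn => /orP[ki|ik]; first by rewrite tB ?mulr0.
by rewrite tA ?mul0r.
Qed.

Lemma trig_horner_mx n (A : 'M[F]_n.+1) p : is_trig_mx A ->
  is_trig_mx (horner_mx A p) /\ forall i, horner_mx A p i i = p.[A i i].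
Proof.
move=> tA; elim/poly_ind: p => [|p c [tp dp]].
  rewrite rmorph0; split; first exact: mx0_is_trig.
  by move=> i; rewrite mxE horner0.
rewrite rmorphD rmorphM /= horner_mx_X horner_mx_C.
have [tpA dpA] := trig_mulmx tp tA; split=> [|i]; last first.
  by rewrite mxE dpA dp mxE eqxx mulr1n !hornerE.
apply/is_trig_mxP => i j ij; rewrite mxE (is_trig_mxP tpA) // mxE.
by rewrite -val_eqE ltn_eqF // mulr0n addr0.
Qed.

(** Factor A = L M through its rank r: then M L has the same trace, is again
    nilpotent, and has size r, which is smaller than n since a nilpotent matrix of
    positive size is singular. *)
Lemma mxtrace_nilpotent n (A : 'M[F]_n) k : A ^+ k = 0 -> \tr A = 0.
Proof.
elim: n {-2}n (leqnn n) A k => [|m IH] n.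
  by rewrite leqn0 => /eqP-> A k _; rewrite /mxtrace big_ord0.
move=> le A k Ak0.
have [rn|rn] := eqVneq (\rank A) n.
  have uA : A \in unitmx by rewrite -row_free_unit /row_free rn.
  case: n => [|n] in A le Ak0 rn uA *; first by rewrite /mxtrace big_ord0.
  have : A ^+ k \is a GRing.unit by apply: unitrX.
  by rewrite Ak0 unitr0.
have [r [L [M [LM rlt]]]] : exists r (L : 'M[F]_(n, r)) (M : 'M[F]_(r, n)),
    L *m M = A /\ (r < n)%N.
  exists (\rank A), (col_base A), (row_base A).
  by rewrite mulmx_base ltn_neqAle rn rank_leq_row.
rewrite -LM mxtrace_mulC; apply: (IH _ _ _ k.+1).
  by rewrite -ltnS (leq_trans rlt).
have key j : (M *m L) ^+ j.+1 = M *m A ^+ j *m L.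
  elim: j => [|j IHj]; first by rewrite expr1 expr0 mulmx1.
  by rewrite exprSr IHj [A ^+ j.+1]exprSr -mulmxE -{3}LM !mulmxA.
by rewrite key Ak0 mulmx0 mul0mx.
Qed.

End Triangular.

(** * A trace criterion for nilpotency *)

Section NilpotencyCriterion.
Variables (C : numClosedFieldType) (n : nat).
Implicit Types (X Y Z : 'M[C]_n.+1).

Let commx_fact X : linear (fun Z : 'M[C]_n.+1 => X * Z - Z * X).
Proof.
move=> a Y Z; rewrite mulrDr mulrDl scalerBr scalerAr scalerAl.
by rewrite opprD addrACA.
Qed.

Definition commx X Z := X * Z - Z * X.

HB.instance Definition _ X :=
  GRing.isLinear.Build C 'M[C]_n.+1 'M[C]_n.+1 _ (commx X) (commx_fact X).

(** Everything needed about the spectrum comes from a triangular form of X, whose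
    diagonal is d: multiplicities are at most the size, so a polynomial divisible
    by that power of X - a for every eigenvalue a is a multiple of the
    characteristic polynomial. *)
Lemma horner_mx_eigenvalues X : exists2 rs : seq C, uniq rs &
  (forall p, (forall a, a \in rs -> ('X - a%:P) ^+ n.+1 %| p) ->
     horner_mx X p = 0)
  /\ exists d : 'I_n.+1 -> C, (forall i, d i \in rs) /\
    (forall p, \tr (horner_mx X p) = \sum_i p.[d i])
    /\ horner_mx X (\prod_i ('X - (d i)%:P)) = 0.
Proof.
have [P /unitarymx_unit uP tT] := @Schur C _ X (ltn0Sn n).
pose T := conjmx P X; rewrite -/T in tT.
have hX p : horner_mx X p = invmx P *m horner_mx T p *m P.
  by rewrite /T conjumx // horner_mx_uconj // !mulmxA mulVmx // mul1mx mulmxKV.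
pose d i := T i i.
have chi0 : horner_mx X (\prod_i ('X - (d i)%:P)) = 0.
  rewrite hX -char_poly_trig //.
  by rewrite Cayley_Hamilton mulmx0 mul0mx.
exists (undup (codom d)); first exact: undup_uniq.
split=> [p hp|].
  have /dvdpP[q ->] : \prod_i ('X - (d i)%:P) %| p.
    apply: dvdp_trans (dvdp_prod_XsubC_exp (undup_uniq (codom d)) hp).
    have -> : \prod_i ('X - (d i)%:P) = \prod_(a <- codom d) ('X - a%:P).
      by rewrite big_image.
    rewrite -prodr_undup_exp_count.
    apply: (big_ind2 (fun p q => p %| q)); first exact: dvdpp.
      by move=> *; apply: dvdp_mul.
    move=> a _; apply: dvdp_exp2l.
    by rewrite (leq_trans (count_size _ _)) // size_codom card_ord.
  by rewrite rmorphM /= chi0 mulr0.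
exists d; split=> [i|]; first by rewrite mem_undup codom_f.
split=> // p; have [_ dp] := trig_horner_mx p tT.
rewrite hX mxtrace_mulC mulKVmx //.
by apply: eq_bigr => i _; rewrite dp.
Qed.

(** Write l for the eigenvalues of X and V_l for its generalized eigenspaces.
    The matrix Y = u(X), with u congruent to the conjugate of l modulo a
    high power of t - l, acts on V_l as the scalar conj l, so tr (X Y) is the
    sum of the |l|^2.  To test the trace hypothesis on Y one needs ad Y to map B into
    A.  On Hom(V_m, V_l) the operator ad X - (l - m) is nilpotent while ad Y is
    the scalar conj (l - m); hence ad Y = r(ad X) for any polynomial r congruent
    to conj (l - m) modulo a high power of t - (l - m).  The case l = m makes r
    divisible by t, and ad X maps B into A. *)
Lemma nilpotent_criterion_pos X (A B : {vspace 'M[C]_n.+1}) :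
    (A <= B)%VS -> (forall Z, Z \in B -> commx X Z \in A) ->
    (forall Y, (forall Z, Z \in B -> commx Y Z \in A) -> \tr (X * Y) = 0) ->
  exists k, X ^+ k = 0.
Proof.
move=> /subvP sAB XB trXY.
have [rs urs [van [d [d_rs [tr_d chi0]]]]] := horner_mx_eigenvalues X.
have [u hu] := poly_interpolation rs n.+1 Num.conj.
(* e l (X) is the projection onto the generalized eigenspace of l. *)
have /boolp.choice[e he] : forall l : C, exists p : {poly C},
    forall a, a \in rs -> ('X - a%:P) ^+ n.+1 %| p - ((a == l)%:R)%:P.
  move=> l; exact: (poly_interpolation rs n.+1 (fun a => (a == l)%:R)).
pose diffs := [seq a - b | a <- rs, b <- rs].
(* Listing 0 makes X divide r without exhibiting an eigenvalue. *)
have [r hr] := poly_interpolation (0 :: diffs) (n.+1 + n.+1) Num.conj.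
pose Y := horner_mx X u; pose E l := horner_mx X (e l).
have sumE : \sum_(l <- rs) E l = 1.
  apply/eqP; rewrite -subr_eq0 -(rmorph1 (horner_mx X)) /E -rmorph_sum -rmorphB /=.
  apply/eqP/van => a a_rs.
  have -> : 1 = \sum_(l <- rs) ((a == l)%:R)%:P :> {poly C}.
    by rewrite (bigD1_seq a) //= eqxx big1 ?addr0 // => l /negPf; rewrite eq_sym => ->.
  rewrite -sumrB; elim/big_ind: _ => [|p q pd qd|l _].
  - exact: dvdp0.
  - exact: dvdp_add.
  - exact: he.
have killE l p : (l \in rs -> ('X - l%:P) ^+ n.+1 %| p) -> horner_mx X p * E l = 0.
  move=> hp; rewrite -rmorphM /=; apply: van => a a_rs.
  have [al|al] := eqVneq a l; first by rewrite al dvdp_mulr // hp // -al.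
  by have := he l a a_rs; rewrite (negPf al) subr0 => ?; rewrite dvdp_mull.
have commE l p : E l * horner_mx X p = horner_mx X p * E l.
  by rewrite -!rmorphM mulrC.
have YE l : l \in rs -> Y * E l = l^* *: E l.
  move=> l_rs; apply/eqP; rewrite -subr_eq0 -mul_scalar_mx -(horner_mx_C X) mulmxE.
  by rewrite -mulrBl -rmorphB /= killE // => _; apply: hu.
have XlE l : X - l%:M = horner_mx X ('X - l%:P).
  by rewrite rmorphB /= horner_mx_X horner_mx_C.
have XE l : (X - l%:M) ^+ n.+1 * E l = 0.
  by rewrite XlE -rmorphXn killE.
have YZ Z : commx Y Z = poly_act (commx X) r Z.
  have {1 2}-> : Z = \sum_(l <- rs) \sum_(m <- rs) E l * Z * E m.
    under eq_bigr => l _ do rewrite -mulr_sumr sumE mulr1.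
    by rewrite -mulr_suml sumE mul1r.
  rewrite linear_sum poly_act_sum; apply: eq_big_seq => l l_rs.
  rewrite linear_sum poly_act_sum; apply: eq_big_seq => m m_rs.
  have /hr/dvdpP[q qr] : l - m \in 0 :: diffs.
    by apply: mem_behead; apply: (allpairs_f (fun a b => a - b)).
  rewrite -[r](subrK (l - m)^*%:P) qr poly_actD poly_actC poly_actM poly_actXsubC_exp.
  rewrite (@eq_iter _ _ (fun Z => (X - l%:M) * Z - Z * (X - m%:M))) => [|T].
    rewrite iter_ad_nilpotent ?poly_act0 ?add0r ?rmorphB ?scalerBl.
    - rewrite /= /commx 2!mulrA YE // -[_ * Y]mulrA commE YE //.
      by rewrite -!scalerAl -scalerAr.
    - by rewrite !mulrA XE !mul0r.
    - by rewrite XlE -rmorphXn -[_ * E m * _]mulrA commE killE ?mulr0.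
  rewrite /= /commx mulrBl mulrBr [l%:M * T]mul_scalar_mx [T * m%:M]mul_mx_scalar.
  by rewrite scalerBl !opprB [m *: T - _]addrC [m *: T - _]addrC addrACA.
have : \tr (X * Y) = 0.
  apply: trXY => Z ZB; rewrite YZ.
  have /dvdpP[q ->] : 'X %| r.
    have := hr 0 (mem_head _ _); rewrite conjC0 subr0 subr0.
    by apply: dvdp_trans; rewrite exprS dvdp_mulr.
  rewrite poly_actMX /poly_act; apply: rpred_sum => i _; apply: rpredZ.
  by elim: (nat_of_ord i) => [|j IH] /=; apply: XB => //; apply: sAB.
rewrite -{1}(horner_mx_X X) -rmorphM /= tr_d => tr0.
have u_d i : u.[d i] = (d i)^*.
  have := hu _ (d_rs i); rewrite exprS => /(dvdp_trans (dvdp_mulr _ (dvdpp _))).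
  by rewrite dvdp_XsubCl rootE !hornerE subr_eq0 => /eqP.
have d0 i : d i = 0.
  move: tr0; under eq_bigr => j _ do rewrite hornerM hornerX u_d.
  move=> /eqP; rewrite psumr_eq0 => [/allP/(_ i)|j _]; last exact: mul_conjC_ge0.
  by rewrite mem_index_enum /= mul_conjC_eq0 => /(_ isT)/eqP.
exists n.+1; rewrite -[X]horner_mx_X -rmorphXn -[RHS]chi0; congr (horner_mx X _).
under eq_bigr => i _ do rewrite d0 subr0.
by rewrite prodr_const card_ord.
Qed.

End NilpotencyCriterion.

Lemma nilpotent_criterion (C : numClosedFieldType) n (X : 'M[C]_n)
    (A B : {vspace 'M[C]_n}) :
    (A <= B)%VS -> (forall Z, Z \in B -> X *m Z - Z *m X \in A) ->
    (forall Y, (forall Z, Z \in B -> Y *m Z - Z *m Y \in A) ->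
       \tr (X *m Y) = 0) ->
  exists k, X ^+ k = 0.
Proof.
case: n => [|n] in X A B *; last exact: nilpotent_criterion_pos.
by move=> _ _ _; exists 1%N; rewrite flatmx0.
Qed.

(** * Subspaces and traces of endomorphisms *)

Section VectorSpaces.
Variables (F : fieldType) (V : vectType F).

(** A subspace of maximal dimension among those contained in P is all of P. *)
Lemma vspace_of_pred (P : V -> Prop) : P 0 ->
    (forall a u v, P u -> P v -> P (a *: u + v)) ->
  exists U : {vspace V}, forall v, v \in U <-> P v.
Proof.
move=> P0 PS.
pose Q d := `[< exists2 U : {vspace V}, \dim U = d & forall v, v \in U -> P v >].
have exQ : exists d, Q d.
  exists 0%N; apply/asboolP; exists 0%VS; first exact: dimv0.
  by move=> v; rewrite memv0 => /eqP->.
have ubQ d : Q d -> (d <= \dim {:V})%N.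
  by move=> /asboolP[U <- _]; rewrite dimvS // subvf.
case: (ex_maxnP exQ ubQ) => d /asboolP[U dU PU] maxd.
exists U => v; split=> [|Pv]; first exact: PU.
apply/negPn/negP => vU.
have /maxd : Q (\dim (U + <[v]>)%VS).
  apply/asboolP; exists (U + <[v]>)%VS => // w /memv_addP[u uU [_ /vlineP[a ->] ->]].
  by rewrite addrC; apply: PS => //; apply: PU.
rewrite -dU leqNgt => /negP; apply.
rewrite (ltn_leqif (dimv_leqif_sup (addvSl _ _))) subv_add subvv /=.
by apply: contra vU => /subvP; apply; apply: memv_line.
Qed.

Lemma span_ind (P : V -> Prop) (X : seq V) : P 0 ->
    (forall a u v, P u -> P v -> P (a *: u + v)) ->
    (forall v, v \in X -> P v) ->
  forall v, v \in <<X>>%VS -> P v.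
Proof.
move=> P0 PS PX; have [U hU] := vspace_of_pred P0 PS.
move=> v vX; apply/hU; apply: subvP vX; apply/span_subvP => w wX.
exact/hU/PX.
Qed.

Definition endmx (f : 'End(V)) := mxof (vbasis {:V}) (vbasis {:V}) f.
Definition ltrace (f : 'End(V)) : F := \tr (endmx f).

Lemma endmx_linear a f g : endmx (a *: f + g) = a *: endmx f + endmx g.
Proof. by rewrite /endmx linearP. Qed.

Lemma endmxB f g : endmx (f - g) = endmx f - endmx g.
Proof. by rewrite /endmx linearB. Qed.

Lemma endmx_comp f g : endmx (f \o g)%VF = endmx g *m endmx f.
Proof. by rewrite /endmx (mxof_comp _ _ (vbasisP _)). Qed.

Lemma ltrace_linear a f g : ltrace (a *: f + g) = a * ltrace f + ltrace g.
Proof. by rewrite /ltrace endmx_linear mxtraceD mxtraceZ. Qed.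

Lemma ltraceC f g : ltrace (f \o g)%VF = ltrace (g \o f)%VF.
Proof. by rewrite /ltrace !endmx_comp mxtrace_mulC. Qed.

Lemma ltraceB f g : ltrace (f - g) = ltrace f - ltrace g.
Proof. by rewrite addrC -scaleN1r ltrace_linear mulN1r addrC. Qed.

Lemma ltrace_sum J (r : seq J) (f : J -> 'End(V)) :
  ltrace (\sum_(i <- r) f i) = \sum_(i <- r) ltrace (f i).
Proof. by rewrite /ltrace /endmx !raddf_sum. Qed.

Lemma endmx_nilpotentP (f : 'End(V)) k :
  endmx f ^+ k = 0 <-> forall v, iter k f v = 0.
Proof.
have key v : rVof (vbasis {:V}) (iter k f v) = rVof (vbasis {:V}) v *m endmx f ^+ k.
  elim: k => [|k IH]; first by rewrite expr0 mulmx1.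
  by rewrite iterS (rVof_app _ (vbasisP _)) // IH exprSr mulmxA.
split=> [f0 v|f0].
  apply: (can_inj (rVofK (vbasisP {:V}))).
  by rewrite key f0 mulmx0 linear0.
apply/row_matrixP => i; rewrite rowE.
rewrite -[delta_mx _ _](vecofK (vbasisP {:V})).
by rewrite -key f0 !linear0.
Qed.

Lemma ltrace_nilpotent (f : 'End(V)) k : (forall v, iter k f v = 0) -> ltrace f = 0.
Proof. by move=> /endmx_nilpotentP; apply: mxtrace_nilpotent. Qed.

End VectorSpaces.

(** * Ideals and nilpotency in Lie algebras *)

Section LieBasics.
Variables (F : fieldType) (g : lieAlgType F).
Implicit Types (x y z : g) (A B I T : {vspace g}).

Fact lieb_linear x : linear (lieb x).
Proof. by move=> a y z; rewrite liebDr liebZr. Qed.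
HB.instance Definition _ x := GRing.isLinear.Build F g g _ (lieb x) (lieb_linear x).

Definition ad x : 'End(g) := linfun (lieb x).

Lemma adE x y : ad x y = lieb x y. Proof. by rewrite lfunE. Qed.

Lemma lieb0x x : lieb 0 x = 0.
Proof. by have := liebZl 0 0 x; rewrite !scale0r. Qed.

Lemma lieb_linearl x a y z : lieb (a *: y + z) x = a *: lieb y x + lieb z x.
Proof. by rewrite liebDl liebZl. Qed.

Lemma liebC x y : lieb x y = - lieb y x.
Proof.
apply/eqP; rewrite -addr_eq0; apply/eqP.
by have := liebxx (x + y); rewrite liebDl !liebDr !liebxx addr0 add0r.
Qed.

Lemma lieb_lieb x y z : lieb (lieb x y) z = lieb x (lieb y z) - lieb y (lieb x z).
Proof.
apply/eqP; rewrite eq_sym -subr_eq0 (liebC (lieb x y)) (liebC x z) linearN /=.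
by rewrite !opprK lieb_jacobi.
Qed.

Lemma ad_linear a x y : ad (a *: x + y) = a *: ad x + ad y.
Proof. by apply/lfunP => z; rewrite add_lfunE scale_lfunE !adE lieb_linearl. Qed.

Lemma ad_lieb x y : ad (lieb x y) = (ad x \o ad y)%VF - (ad y \o ad x)%VF.
Proof. by apply/lfunP => z; rewrite add_lfunE opp_lfunE !comp_lfunE !adE lieb_lieb. Qed.

Lemma lie_ideal_r I x y : lie_ideal I -> x \in I -> lieb x y \in I.
Proof. by move=> idI xI; rewrite liebC memvN idI. Qed.

Lemma lie_ideal_cap I T : lie_ideal I -> lie_ideal T -> lie_ideal (I :&: T)%VS.
Proof.
by move=> idI idT x y; rewrite !memv_cap => /andP[yI yT]; rewrite idI // idT.
Qed.

Lemma lie_ideal_prod I T : lie_ideal I -> lie_ideal T -> lie_ideal (lie_prod I T).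
Proof.
move=> idI idT x; apply: span_ind => [|a u v|_ /allpairsP[[u v] /= [uI vT ->]]].
- by rewrite linear0 mem0v.
- by rewrite linearP => uP vP; rewrite memvD // memvZ.
have -> : lieb x (lieb u v) = lieb (lieb x u) v + lieb u (lieb x v).
  by rewrite lieb_lieb subrK.
by rewrite memvD // memv_lie_prod ?idI ?idT // vbasis_mem.
Qed.

Lemma lie_prod_subr I T : lie_ideal T -> (lie_prod I T <= T)%VS.
Proof. by move=> idT; apply/lie_prod_subP => x y _; apply: idT. Qed.

Lemma semisimple_abelian_ideal : lie_semisimple g -> forall I, lie_ideal I ->
  (forall x y, x \in I -> y \in I -> lieb x y = 0) -> I = 0%VS.
Proof.
move=> ss I idI abI; apply: ss => //; exists 1%N; apply/eqP; rewrite -subv0.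
by apply/lie_prod_subP => x y xI yI; rewrite abI ?mem0v.
Qed.

Definition subalgebra T := forall x y, x \in T -> y \in T -> lieb x y \in T.

(** Engel's theorem for T acting on a subquotient B / A of the adjoint
    representation: T kills a nonzero vector of B / A.  Only subquotients of g
    are needed, because the induction applies the statement to T / S for a maximal
    proper subalgebra S.  It provides y in T with [S, y] inside S, so that S + <y>
    is a subalgebra, hence equal to T; and y acts nilpotently on the nonzero space
    of vectors killed by S. *)
Lemma engel T : subalgebra T ->
    (forall x, x \in T -> exists k, forall z, iter k (lieb x) z = 0) ->
  forall A B, (A <= B)%VS -> ~~ (B <= A)%VS ->
    (forall t a, t \in T -> a \in A -> lieb t a \in A) ->
    (forall t b, t \in T -> b \in B -> lieb t b \in B) ->
  exists v, [/\ v \in B, v \notin A & forall t, t \in T -> lieb t v \in A].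
Proof.
move: {2}(\dim T).+1 (ltnSn (\dim T)) => N.
elim: N T => // N IH T; rewrite ltnS => dT algT nilT A B sAB nBA TA TB.
have [T0|T0] := eqVneq T 0%VS.
  have /subvPn[v vB vA] := nBA; exists v; split=> // t.
  by rewrite T0 memv0 => /eqP->; rewrite lieb0x mem0v.
(* Let S be a maximal proper subalgebra of T. *)
pose Q d := `[< exists S,
  [/\ \dim S = d, subalgebra S, (S <= T)%VS & ~~ (T <= S)%VS] >].
have exQ : exists d, Q d.
  exists 0%N; apply/asboolP; exists 0%VS; split; rewrite ?dimv0 ?sub0v ?subv0 //.
  by move=> x y; rewrite !memv0 => /eqP-> _; rewrite lieb0x.
have ubQ d : Q d -> (d <= \dim T)%N.
  by move=> /asboolP[S [<- _ ST _]]; rewrite dimvS.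
case: (ex_maxnP exQ ubQ) => d /asboolP[S [dS algS sST nTS]] maxd.
have dST : (\dim S < \dim T)%N by rewrite (ltn_leqif (dimv_leqif_sup sST)).
have {}IH := IH S (leq_trans dST dT) algS (fun x xS => nilT x (subvP sST x xS)).
have [|y [yT yS Sy]] := IH S T sST nTS algS.
  by move=> t b /(subvP sST); apply: algT.
have defT : (S + <[y]>)%VS = T.
  have sS'T : (S + <[y]> <= T)%VS by rewrite subv_add sST -memvE.
  apply/eqP; rewrite eqEsubv sS'T /=; apply/negPn/negP => nT.
  have /maxd : Q (\dim (S + <[y]>)%VS).
    apply/asboolP; exists (S + <[y]>)%VS; split=> // u v.
    move=> /memv_addP[s sS [_ /vlineP[a ->] ->]].
    move=> /memv_addP[s' s'S [_ /vlineP[b ->] ->]].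
    apply: (subvP (addvSl _ _)).
    rewrite liebDl !liebDr !liebZl !liebZr liebxx !scaler0 addr0 (liebC y).
    apply: memvD; last by apply: memvZ; rewrite memvN; apply: Sy.
    by apply: memvD; [apply: algS | apply/memvZ/Sy].
  rewrite -dS leqNgt => /negP; apply.
  rewrite (ltn_leqif (dimv_leqif_sup (addvSl _ _))) subv_add subvv /=.
  by apply: contra yS => /subvP; apply; apply: memv_line.
have [|t b /(subvP sST)|v [vB vA Sv]] := IH A B sAB nBA.
- by move=> t a /(subvP sST); apply: TA.
- exact: TB.
(* The vectors that S maps into A are stable under the nilpotent y. *)
have yv k : iter k (lieb y) v \in B /\
    forall s, s \in S -> lieb s (iter k (lieb y) v) \in A.
  elim: k => [//|k [kB kS]]; split=> [|s sS /=]; first exact: TB.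
  have -> w : lieb s (lieb y w) = lieb (lieb s y) w + lieb y (lieb s w).
    by rewrite lieb_lieb subrK.
  by apply: memvD; [apply/kS/Sy | apply/TA/kS].
have exk : exists k, iter k (lieb y) v \in A.
  by have [k yk0] := nilT y yT; exists k; rewrite yk0 mem0v.
case: (ex_minnP exk) => -[|k] kA mink; first by rewrite kA in vA.
exists (iter k (lieb y) v); have [kB kS] := yv k; split=> //.
  by apply/negP => /mink; rewrite ltnn.
move=> t; rewrite -defT => /memv_addP[s sS [_ /vlineP[a ->] ->]].
by rewrite liebDl liebZl; apply: memvD; [apply: kS | apply: memvZ].
Qed.

(** By Engel's theorem for the adjoint action, a nonzero such ideal would have
    a nonzero center; that center is an abelian ideal of the whole algebra. *)
Lemma semisimple_ad_nilpotent_ideal : lie_semisimple g -> forall I, lie_ideal I ->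
  (forall x, x \in I -> exists k, forall z, iter k (lieb x) z = 0) -> I = 0%VS.
Proof.
move=> ss I idI nilI; apply/eqP/negPn/negP => I0.
have [|||v [vI v0 Iv]] := engel (fun x y _ yI => idI x y yI) nilI (sub0v I).
- by rewrite subv0.
- by move=> t a _; rewrite !memv0 => /eqP->; rewrite linear0.
- by move=> t b _; apply: idI.
have [Z hZ] : exists Z : {vspace g}, forall z, z \in Z <->
    (z \in I /\ forall t, t \in I -> lieb t z = 0).
  apply: vspace_of_pred => [|a u w [uI Iu] [wI Iw]].
    by split=> [|t _]; rewrite ?mem0v ?linear0.
  by split=> [|t tI]; rewrite ?memvD ?memvZ // linearP /= Iu // Iw // scaler0 addr0.
have Z0 : Z = 0%VS.
  apply: semisimple_abelian_ideal => // [x z /hZ[zI Iz]|x y /hZ[xI _] /hZ[_ ->//]].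
  apply/hZ; split=> [|t tI]; first exact: idI.
  have -> : lieb t (lieb x z) = lieb (lieb t x) z + lieb x (lieb t z).
    by rewrite lieb_lieb subrK.
  by rewrite Iz ?lie_ideal_r // Iz // linear0 addr0.
move: v0; rewrite -{1}Z0 => /negP; apply; apply/hZ; split=> // t /Iv.
by rewrite memv0 => /eqP.
Qed.

(** * Orthogonality for an invariant form *)

Section InvariantForm.
Variable B : g -> g -> F.
Hypothesis B_linear : forall a x y z, B (a *: x + y) z = a * B x z + B y z.
Hypothesis B_sym : forall x y, B x y = B y x.
Hypothesis B_inv : forall x y z, B (lieb x y) z = B x (lieb y z).

Lemma form_linearr a x y z : B z (a *: x + y) = a * B z x + B z y.
Proof. by rewrite !(B_sym z) B_linear. Qed.

Lemma invform0r x : B x 0 = 0.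
Proof. by have := form_linearr (-1) 0 0 x; rewrite scaler0 addr0 mulN1r addNr. Qed.

Fact orth_fact I : linear (fun x => \row_(j < \dim I) B x (vbasis I)`_j).
Proof. by move=> a x y; apply/rowP => j; rewrite !mxE B_linear. Qed.
Definition orth_row I x := \row_(j < \dim I) B x (vbasis I)`_j.
HB.instance Definition _ I := GRing.isLinear.Build F g 'rV_(\dim I) _
  (orth_row I) (orth_fact I).

Definition orth I : {vspace g} := lker (linfun (orth_row I)).

Lemma vanish_on_vbasis I x : (forall j : 'I_(\dim I), B x (vbasis I)`_j = 0) ->
  forall y, y \in I -> B x y = 0.
Proof.
move=> H; rewrite -{1}(span_basis (vbasisP I)).
apply: (@span_ind _ _ (fun y => B x y = 0)) => [|a u v xu xv|v /(nthP 0)[j]].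
- exact: invform0r.
- by rewrite form_linearr xu xv mulr0 addr0.
- by rewrite size_tuple => jI <-; have := H (Ordinal jI).
Qed.

Lemma orthP I x : reflect (forall y, y \in I -> B x y = 0) (x \in orth I).
Proof.
apply: (iffP idP) => [|H].
  rewrite memv_ker lfunE => /eqP /rowP H; apply: vanish_on_vbasis => j.
  by have := H j; rewrite !mxE.
rewrite memv_ker lfunE; apply/eqP/rowP => j; rewrite !mxE H //.
by rewrite vbasis_mem // memt_nth.
Qed.

Lemma orth_ideal I : lie_ideal I -> lie_ideal (orth I).
Proof.
move=> idI z x /orthP xI; apply/orthP => y yI.
rewrite liebC -scaleN1r -[_ *: _]addr0 B_linear B_inv xI ?idI //.
by rewrite B_sym invform0r mulr0 addr0.
Qed.

Lemma dim_orth I : (\dim {:g} <= \dim I + \dim (orth I))%N.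
Proof.
rewrite -(limg_ker_dim (linfun (orth_row I)) fullv) capfv addnC leq_add2r.
by rewrite (leq_trans (dimvS (subvf _))) // dimvf /dim /= mul1n.
Qed.

Section DualBasis.
Variable N : {vspace g}.
Hypothesis B_nondeg : forall x, x \in N -> (forall y, y \in N -> B x y = 0) -> x = 0.
Local Notation b i := (vbasis N)`_i.

Lemma dual_basis_exists : exists e : 'I_(\dim N) -> g,
  (forall i, e i \in N) /\ forall i j : 'I_(\dim N), B (e i) (b j) = (i == j)%:R.
Proof.
have surj : (linfun (orth_row N) @: N = fullv)%VS.
  apply/eqP; rewrite eqEdim subvf /= dimvf /dim /= mul1n limg_dim_eq //.
  apply/eqP; rewrite -subv0; apply/subvP => x; rewrite memv_cap => /andP[xN /orthP xo].
  by rewrite memv0 (B_nondeg xN xo).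
have ex i : exists x, x \in N /\ forall j : 'I_(\dim N), B x (b j) = (i == j)%:R.
  have : delta_mx 0 i \in (linfun (orth_row N) @: N)%VS by rewrite surj memvf.
  move=> /memv_imgP[x xN]; rewrite lfunE => /rowP xd; exists x; split=> // j.
  by have := xd j; rewrite !mxE eqxx eq_sym.
have /boolp.choice[e eP] := ex.
by exists e; split=> [i|i j]; case: (eP i).
Qed.

Variable e : 'I_(\dim N) -> g.
Hypothesis eN : forall i, e i \in N.
Hypothesis e_dual : forall i j : 'I_(\dim N), B (e i) (b j) = (i == j)%:R.

Lemma form_suml J (r : seq J) (a : J -> F) (u : J -> g) z :
  B (\sum_(i <- r) a i *: u i) z = \sum_(i <- r) a i * B (u i) z.
Proof.
elim: r => [|i r IH]; first by rewrite !big_nil B_sym invform0r.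
by rewrite !big_cons B_linear IH.
Qed.

Lemma dual_basis_sum z : z \in N -> z = \sum_(i < \dim N) B z (b i) *: e i.
Proof.
move=> zN; apply/eqP; rewrite -subr_eq0; apply/eqP/B_nondeg.
  by rewrite memvB // memv_suml // => i _; rewrite memvZ.
apply: vanish_on_vbasis => j; rewrite -scaleN1r addrC B_linear form_suml.
rewrite (bigD1 j) //= e_dual eqxx mulr1 big1 ?addr0 ?mulN1r ?addNr // => i /negPf ij.
by rewrite e_dual ij mulr0.
Qed.

Lemma vbasis_dual_sum z : z \in N -> z = \sum_(i < \dim N) B z (e i) *: b i.
Proof.
move=> zN; rewrite {1}(coord_vbasis zN); apply: eq_bigr => i _; congr (_ *: _).
rewrite {2}(coord_vbasis zN) form_suml (bigD1 i) //= B_sym e_dual eqxx mulr1.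
by rewrite big1 ?addr0 // => j /negPf ji; rewrite B_sym e_dual eq_sym ji mulr0.
Qed.

End DualBasis.

End InvariantForm.

End LieBasics.

(** * Cartan's criterion and the Killing form *)

Section TraceForms.
Variables (R : realType) (g : lieAlgType R).
Local Notation C := (R[i]).
Implicit Types (x y z : g) (I : {vspace g}).

(** Cartan's criterion.  The criterion for nilpotency is applied to the complex
    spans of tau(I) and tau(g): for x = [u, v] with v in I, the trace of
    tau(x) Y is, up to sign, that of tau(v) [Y, tau(u)], and [Y, tau(u)] lies in
    the span of tau(I).  The bracket condition is the one satisfied by matrices
    acting on row vectors, which reverse the order of composition. *)
Lemma trace_form_nilpotent n (tau : g -> 'M[C]_n) I :
    (forall a x y, tau (a *: x + y) = a%:C%C *: tau x + tau y) ->
    (forall x y, tau (lieb x y) = tau y *m tau x - tau x *m tau y) ->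
    lie_ideal I ->
    (forall x y, x \in I -> \tr (tau x *m tau y) = 0) ->
  forall x, x \in lie_prod fullv I -> exists k, tau x ^+ k = 0.
Proof.
move=> tauD tauL idI trI x xJ.
have tau0 : tau 0 = 0.
  have := tauD (-1) 0 0; rewrite scaler0 addr0 rmorphN1 scaleN1r => ->.
  by rewrite addNr.
have xI : x \in I by apply: subvP xJ; apply: lie_prod_subr.
pose Sp U := <<[seq tau b | b <- vbasis U]>>%VS.
have SpP (U : {vspace g}) u : u \in U -> tau u \in Sp U.
  rewrite -{1}(span_basis (vbasisP U)).
  apply: (@span_ind _ _ (fun u => tau u \in Sp U)) => [|a v w vU wU|v vU].
  - by rewrite tau0 mem0v.
  - by rewrite tauD; apply: memvD => //; apply: memvZ.
  - by rewrite memv_span ?map_f.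
have Sp_ind (U : {vspace g}) (P : 'M[C]_n -> Prop) :
    P 0 -> (forall a Y Z, P Y -> P Z -> P (a *: Y + Z)) ->
    (forall u, u \in U -> P (tau u)) -> forall Z, Z \in Sp U -> P Z.
  move=> P0 PS PU; apply: span_ind => // _ /mapP[u uU ->].
  by apply: PU; apply: vbasis_mem.
apply: (@nilpotent_criterion _ _ _ (Sp I) (Sp fullv)).
- apply/subvP; apply: Sp_ind => [|a Y Z YB ZB|u _]; first exact: mem0v.
    by apply: memvD => //; apply: memvZ.
  by rewrite SpP ?memvf.
- apply: Sp_ind => [|a Y Z YI ZI|u _].
  + by rewrite mulmx0 mul0mx subrr mem0v.
  + rewrite mulmxDr mulmxDl -scalemxAr -scalemxAl opprD addrACA -scalerBr.
    exact: memvD (memvZ a YI) ZI.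
  + by rewrite -tauL SpP ?idI.
move=> Y YB.
move: x xJ {xI}; apply: span_ind => [|a u v u0 v0|].
- by rewrite tau0 mul0mx mxtrace0.
- by rewrite tauD mulmxDl -scalemxAl mxtraceD mxtraceZ u0 v0 mulr0 addr0.
move=> _ /allpairsP[[u v] /= [_ /vbasis_mem vI ->]].
have trv Z : Z \in Sp I -> \tr (tau v *m Z) = 0.
  move: Z; apply: Sp_ind => [|a M N M0 N0|w _]; first by rewrite mulmx0 mxtrace0.
    by rewrite mulmxDr -scalemxAr mxtraceD mxtraceZ M0 N0 mulr0 addr0.
  exact: trI.
rewrite tauL mulmxBl raddfB /= -!mulmxA [X in _ - X]mxtrace_mulC -mulmxA.
rewrite -raddfB /= -mulmxBr.
by rewrite -opprB mulmxN raddfN /= trv ?oppr0 // YB // SpP ?memvf.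
Qed.

Definition killing x y := ltrace (ad x \o ad y)%VF.

Lemma ltrace_rep_invariant (K : fieldType) (V : vectType K) (rho : g -> 'End(V)) :
    (forall x y, rho (lieb x y) = (rho x \o rho y)%VF - (rho y \o rho x)%VF) ->
  forall x y z, ltrace (rho (lieb x y) \o rho z)%VF =
    ltrace (rho x \o rho (lieb y z))%VF.
Proof.
move=> rhoL x y z; rewrite !rhoL comp_lfunDl comp_lfunNl comp_lfunDr comp_lfunNr.
rewrite !ltraceB.
by congr (_ - _); rewrite ?comp_lfunA // -comp_lfunA ltraceC.
Qed.

Lemma killing_linear a x y z : killing (a *: x + y) z = a * killing x z + killing y z.
Proof. by rewrite /killing ad_linear comp_lfunDl -comp_lfunZl ltrace_linear. Qed.

Lemma killing_sym x y : killing x y = killing y x.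
Proof. exact: ltraceC. Qed.

Lemma killing_inv x y z : killing (lieb x y) z = killing x (lieb y z).
Proof. by apply: ltrace_rep_invariant; apply: ad_lieb. Qed.

Local Notation "I ^!" := (orth killing I).
Let orthKP := orthP killing_linear killing_sym.
Let orthK_ideal := orth_ideal killing_linear killing_sym killing_inv.

Hypothesis ss : lie_semisimple g.

Lemma endmx_ad_nilpotent x k :
  endmx (ad x) ^+ k = 0 -> forall z, iter k (lieb x) z = 0.
Proof.
move=> /endmx_nilpotentP xk0 z; rewrite -[RHS](xk0 z).
by apply: eq_iter => y; rewrite adE.
Qed.

(** Let I be the radical of the Killing form.  By Cartan's criterion the ideal
    [g, I] consists of ad-nilpotent elements, so it is zero; then I is central,
    hence abelian, hence zero. *)
Lemma killing_nondegenerate : orth killing fullv = 0%VS.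
Proof.
have idI : lie_ideal (orth killing fullv) by apply: orthK_ideal => x y _; rewrite memvf.
have idf : lie_ideal (fullv : {vspace g}) by move=> x y _; rewrite memvf.
have J0 : lie_prod fullv (orth killing fullv) = 0%VS.
  apply: semisimple_ad_nilpotent_ideal => //; first exact: lie_ideal_prod.
  move=> x xJ.
  pose tau x := map_mx (real_complex R) (endmx (ad x)).
  have [|||k xk] := @trace_form_nilpotent _ tau _ _ _ idI _ x xJ; rewrite /tau.
  - by move=> a y z; rewrite ad_linear endmx_linear map_mxD map_mxZ.
  - by move=> y z; rewrite ad_lieb endmxB !endmx_comp map_mxB !map_mxM.
  - move=> y z /orthKP yI; rewrite -map_mxM trace_map_mx -endmx_comp.
    by have := yI z (memvf _); rewrite killing_sym /killing /ltrace => ->; rewrite rmorph0.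
  exists k; apply: endmx_ad_nilpotent.
  apply/eqP; rewrite -(map_mx_eq0 (real_complex R)); apply/eqP; rewrite -[RHS]xk.
  by rewrite rmorphXn.
apply: semisimple_abelian_ideal => // x y _ yI.
by apply/eqP; rewrite -memv0 -J0 memv_lie_prod ?memvf.
Qed.

(** For x and y in the intersection, [x, y] is orthogonal to g, so the
    intersection is an abelian ideal. *)
Lemma ideal_cap_orth I : lie_ideal I -> (I :&: I^!)%VS = 0%VS.
Proof.
move=> idI; apply: semisimple_abelian_ideal => //.
  by apply: lie_ideal_cap => //; apply: orthK_ideal.
move=> x y; rewrite !memv_cap => /andP[xI _] /andP[_ /orthKP yI].
apply/eqP; rewrite -memv0 -killing_nondegenerate; apply/orthKP => z _.
by rewrite killing_sym -killing_inv killing_sym yI // idI.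
Qed.

Lemma ideal_add_orth I : lie_ideal I -> (I + I^!)%VS = fullv.
Proof.
move=> idI; apply/eqP; rewrite eqEdim subvf /=.
rewrite dimv_disjoint_sum ?ideal_cap_orth //.
exact: dim_orth.
Qed.

Lemma ideal_lieb_orth I x y : lie_ideal I -> x \in I -> y \in I^! -> lieb x y = 0.
Proof.
move=> idI xI yI; apply/eqP; rewrite -memv0 -(ideal_cap_orth idI) memv_cap.
by rewrite lie_ideal_r //= orthK_ideal.
Qed.

(** The part of I orthogonal to D = [I, I] is abelian, because brackets of its
    elements lie both in D and in the orthogonal of D. *)
Lemma ideal_perfect I : lie_ideal I -> lie_prod I I = I.
Proof.
move=> idI; have idD := lie_ideal_prod idI idI.
apply/eqP; rewrite eqEsubv lie_prod_subr //=; apply/subvP => x xI.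
have cap0 : (I :&: (lie_prod I I)^!)%VS = 0%VS.
  apply: semisimple_abelian_ideal => //.
    by apply: lie_ideal_cap => //; apply: orthK_ideal.
  move=> u v; rewrite !memv_cap => /andP[uI _] /andP[vI vD].
  apply/eqP; rewrite -memv0 -(ideal_cap_orth idD) memv_cap memv_lie_prod //=.
  exact: orthK_ideal.
have : x \in (lie_prod I I + (lie_prod I I)^!)%VS by rewrite ideal_add_orth ?memvf.
move=> /memv_addP[a aD [b bD xab]].
suff b0 : b = 0 by rewrite xab b0 addr0.
apply/eqP; rewrite -memv0 -cap0 memv_cap bD andbT.
have -> : b = x - a by rewrite xab addrAC subrr add0r.
by rewrite memvB //; apply: subvP aD; apply: lie_prod_subr.
Qed.

End TraceForms.

(** * Complex representations and their real trace form *)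

Section BlockDiagonal.
Variables (F : fieldType) (n : nat).
Implicit Types (A B : 'M[F]_n).

Definition bdiag A B : 'M[F]_(n + n) := block_mx A 0 0 B.

Lemma bdiag_linear a A B A' B' :
  bdiag (a *: A + A') (a *: B + B') = a *: bdiag A B + bdiag A' B'.
Proof. by rewrite /bdiag scale_block_mx add_block_mx !scaler0 !addr0. Qed.

Lemma bdiagB A B A' B' : bdiag (A - A') (B - B') = bdiag A B - bdiag A' B'.
Proof. by rewrite /bdiag opp_block_mx add_block_mx oppr0 addr0. Qed.

Lemma bdiag_mul A B A' B' : bdiag (A *m A') (B *m B') = bdiag A B *m bdiag A' B'.
Proof. by rewrite /bdiag mulmx_block !(mulmx0, mul0mx, addr0, add0r). Qed.

Lemma bdiag_exp A B k : bdiag A B ^+ k = bdiag (A ^+ k) (B ^+ k).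
Proof.
elim: k => [|k IH]; first by rewrite !expr0 /bdiag -scalar_mx_block.
by rewrite !exprSr IH -!mulmxE bdiag_mul.
Qed.

Lemma bdiag_eq0 A B : bdiag A B = 0 -> A = 0.
Proof. by move=> /eqP; rewrite /bdiag block_mx_eq0 => /and4P[/eqP]. Qed.

End BlockDiagonal.

Section ComplexRepresentations.
Variables (R : realType) (g : lieAlgType R).
Hypothesis ss : lie_semisimple g.
Local Notation C := (R[i]).
Implicit Types (x y z : g) (I : {vspace g}).

Definition is_rep (V : vectType C) (sigma : g -> 'End(V)) : Prop :=
  (forall a x y, sigma (a *: x + y) = a%:C%C *: sigma x + sigma y) /\
  (forall x y, sigma (lieb x y) =
     (sigma x \o sigma y)%VF - (sigma y \o sigma x)%VF).

Local Notation "I ^!" := (orth (@killing R g) I).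

Section RealTraceForm.
Variables (V : vectType C) (sigma : g -> 'End(V)).
Hypothesis sigma_rep : is_rep sigma.

Lemma rep0 : sigma 0 = 0.
Proof.
have := sigma_rep.1 (-1) 0 0; rewrite scaler0 addr0 rmorphN1 scaleN1r => ->.
by rewrite addNr.
Qed.

Lemma rep_lieb x y v : sigma (lieb x y) v = sigma x (sigma y v) - sigma y (sigma x v).
Proof. by rewrite sigma_rep.2 add_lfunE opp_lfunE !comp_lfunE. Qed.

Lemma rep_ker : exists2 K : {vspace g}, lie_ideal K & forall x, x \in K <-> sigma x = 0.
Proof.
have [K hK] : exists K : {vspace g}, forall x, x \in K <-> sigma x = 0.
  apply: vspace_of_pred => [|a x y x0 y0]; first exact: rep0.
  by rewrite sigma_rep.1 x0 y0 scaler0 addr0.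
exists K => // x y /hK y0; apply/hK.
by rewrite sigma_rep.2 y0 comp_lfun0r comp_lfun0l subrr.
Qed.

(** Up to a factor 2, the trace form of the real representation underlying V.  A
    real-valued form is needed in order to have dual bases in the real algebra g. *)
Definition reform x y : R := complex.Re (ltrace (sigma x \o sigma y)%VF).

Lemma reform_linear a x y z : reform (a *: x + y) z = a * reform x z + reform y z.
Proof.
rewrite /reform sigma_rep.1 comp_lfunDl -comp_lfunZl ltrace_linear.
by case: (ltrace _) (ltrace _) => [u v] [w t] /=; rewrite mul0r subr0.
Qed.

Lemma reform_sym x y : reform x y = reform y x.
Proof. by rewrite /reform ltraceC. Qed.

Lemma reform_inv x y z : reform (lieb x y) z = reform x (lieb y z).
Proof. by rewrite /reform (ltrace_rep_invariant sigma_rep.2). Qed.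

(** The representation on V + conj V has trace form twice the real part of that of
    V, which brings reform within the scope of Cartan's criterion. *)
Lemma rep_nilpotent_of_reform I : lie_ideal I ->
    (forall x y, x \in I -> reform x y = 0) ->
  forall x, x \in lie_prod fullv I -> exists k, endmx (sigma x) ^+ k = 0.
Proof.
move=> idI rI x xJ.
pose cj (M : 'M[C]_(\dim {:V})) := map_mx (@Num.conj C) M.
have cj_linear (a : R) M M' : cj (a%:C%C *: M + M') = a%:C%C *: cj M + cj M'.
  apply/matrixP => i j; rewrite !mxE rmorphD rmorphM /=.
  by rewrite conj_Creal ?complex_real.
have cjB M M' : cj (M - M') = cj M - cj M' by apply: map_mxB.
have cjM M M' : cj (M *m M') = cj M *m cj M' by apply: map_mxM.
pose tau x := bdiag (endmx (sigma x)) (cj (endmx (sigma x))).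
have [||y z yI|k] := @trace_form_nilpotent R g _ tau I _ _ idI _ x xJ.
- move=> a y z; rewrite /tau -bdiag_linear sigma_rep.1 endmx_linear; congr bdiag.
  exact: cj_linear.
- move=> y z; rewrite /tau -!bdiag_mul -bdiagB sigma_rep.2 endmxB !endmx_comp.
  by rewrite cjB !cjM.
- rewrite /tau -bdiag_mul mxtrace_block -cjM trace_map_mx -endmx_comp.
  have := rI _ z yI; rewrite reform_sym /reform /ltrace.
  by case: (\tr _) => [u v] /= ->; apply/eqP; rewrite eq_complex /= addr0 subrr eqxx.
by rewrite bdiag_exp => /bdiag_eq0 ?; exists k.
Qed.

Lemma iter_lieb_sub_ker x k z : endmx (sigma x) ^+ k = 0 ->
  sigma (iter (k + k) (lieb x) z) = 0.
Proof.
move=> xk0.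
have key j : endmx (sigma (iter j (lieb x) z)) =
    iter j (fun Z => - endmx (sigma x) * Z - Z * - endmx (sigma x)) (endmx (sigma z)).
  elim: j => //= j <-; rewrite sigma_rep.2 endmxB !endmx_comp mulNr mulrN opprK.
  by rewrite addrC.
have: endmx (sigma (iter (k + k) (lieb x) z)) ^+ 1 = 0.
  rewrite expr1 key; apply: iter_ad_nilpotent; rewrite exprNn xk0 mulr0 ?mul0r ?mulr0 //.
by move=> /endmx_nilpotentP H; apply/lfunP => v; rewrite lfunE; apply: H.
Qed.

(** The radical I of the form on the complement of the kernel is an ideal, so it is
    perfect and Cartan's criterion makes sigma nilpotent on it.  As sigma is
    faithful there, its elements are ad-nilpotent, and the Killing form vanishes
    on I; but its restriction to an ideal is nondegenerate. *)
Lemma reform_nondegenerate (K : {vspace g}) : lie_ideal K ->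
    (forall x, x \in K <-> sigma x = 0) ->
  forall x, x \in K^! -> (forall y, y \in K^! -> reform x y = 0) -> x = 0.
Proof.
move=> idK hK x xN xorth.
have idN : lie_ideal K^!.
  exact: (orth_ideal (@killing_linear R g) (@killing_sym R g) (@killing_inv R g)).
pose I := (orth reform fullv :&: K^!)%VS.
have idrad : lie_ideal (orth reform fullv).
  apply: (orth_ideal reform_linear reform_sym reform_inv).
  by move=> u v _; rewrite memvf.
have idI : lie_ideal I by apply: lie_ideal_cap.
have nil_killing u : u \in I -> killing u u = 0.
  move=> uI.
  have [||k uk] := @rep_nilpotent_of_reform I idI _ u.
  - move=> y z; rewrite memv_cap => /andP[/(orthP reform_linear reform_sym) H _].
    by rewrite H ?memvf.
  - rewrite -(ideal_perfect ss idI) in uI; apply: subvP uI.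
    by apply/lie_prod_subP => y z _ zI; rewrite memv_lie_prod ?memvf.
  have adu z : iter (k + k).+1 (ad u) z = 0.
    rewrite (@eq_iter _ _ (lieb u)) => [|w]; last exact: adE.
    rewrite iterS; have /hK zK := iter_lieb_sub_ker z uk.
    rewrite liebC (ideal_lieb_orth ss idK zK) ?oppr0 //.
    by move: uI; rewrite memv_cap => /andP[].
  rewrite /killing /ltrace endmx_comp; apply: (@mxtrace_nilpotent _ _ _ (k + k).+1).
  have /endmx_nilpotentP uk0 := adu.
  by rewrite -[_ *m _]/(_ ^+ 2) -exprM mulnC exprM uk0 expr0n.
have xI : x \in I.
  rewrite memv_cap xN andbT; apply/(orthP reform_linear reform_sym) => y _.
  have : y \in (K + K^!)%VS by rewrite ideal_add_orth ?memvf.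
  move=> /memv_addP[a /hK a0 [b bN ->]].
  rewrite -[a]scale1r (form_linearr reform_linear reform_sym) (xorth b bN) addr0 mul1r.
  by rewrite /reform a0 comp_lfun0r /ltrace /endmx linear0 mxtrace0.
apply/eqP; rewrite -memv0 -(ideal_cap_orth ss idI) memv_cap xI.
apply/(orthP (@killing_linear R g) (@killing_sym R g)) => y yI.
have := nil_killing _ (memvD xI yI).
have killingDl u v w : killing (u + v) w = killing u w + killing v w.
  by rewrite -[u]scale1r killing_linear mul1r scale1r.
rewrite killingDl !(killing_sym _ (x + y)) !killingDl !nil_killing // add0r addr0.
by rewrite (killing_sym y) -mulr2n => /eqP; rewrite mulrn_eq0 => /eqP.
Qed.

Lemma rep_sum J (r : seq J) (W : lmodType C) (f : g -> W) (a : J -> R) (u : J -> g) :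
    (forall a x y, f (a *: x + y) = a%:C%C *: f x + f y) ->
  f (\sum_(i <- r) a i *: u i) = \sum_(i <- r) (a i)%:C%C *: f (u i).
Proof.
move=> fD; elim: r => [|i r IH]; last by rewrite !big_cons fD IH.
rewrite !big_nil; have := fD (-1) 0 0.
by rewrite scaler0 addr0 rmorphN1 scaleN1r addNr.
Qed.

(** * The Casimir operator *)

Section Casimir.
Variable N : {vspace g}.
Hypothesis idN : lie_ideal N.
Hypothesis N_nondeg :
  forall x, x \in N -> (forall y, y \in N -> reform x y = 0) -> x = 0.
Variable e : 'I_(\dim N) -> g.
Hypothesis eN : forall i, e i \in N.
Hypothesis e_dual :
  forall i j : 'I_(\dim N), reform (e i) (vbasis N)`_j = (i == j)%:R.
Local Notation b i := (vbasis N)`_i.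

(** The tensor of a pair of dual bases is invariant: the coefficients of
    [x, b_i] and [x, e_i] in the two bases are opposite transposes, because the
    form is invariant. *)
Lemma casimir_invariance (W : lmodType C) (T : g -> g -> W) x :
    (forall a x y z, T (a *: x + y) z = a%:C%C *: T x z + T y z) ->
    (forall a x y z, T z (a *: x + y) = a%:C%C *: T z x + T z y) ->
  \sum_(i < \dim N) (T (lieb x (b i)) (e i) + T (b i) (lieb x (e i))) = 0.
Proof.
move=> Tl Tr; have bN (i : 'I_(\dim N)) : b i \in N by rewrite vbasis_mem // memt_nth.
rewrite big_split /=.
have -> : \sum_(i < \dim N) T (lieb x (b i)) (e i) =
   \sum_(i < \dim N) \sum_(k < \dim N)
     (reform (lieb x (b i)) (e k))%:C%C *: T (b k) (e i).
  apply: eq_bigr => i _.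
  rewrite {1}[lieb x _](vbasis_dual_sum reform_linear reform_sym e_dual) ?idN //.
  exact: (rep_sum _ (f := fun y => T y (e i))).
have -> : \sum_(i < \dim N) T (b i) (lieb x (e i)) =
   \sum_(i < \dim N) \sum_(k < \dim N)
     (reform (lieb x (e i)) (b k))%:C%C *: T (b i) (e k).
  apply: eq_bigr => i _.
  rewrite {1}[lieb x _](dual_basis_sum reform_linear reform_sym N_nondeg eN e_dual) ?idN //.
  exact: (rep_sum _ (f := T (b i))).
rewrite [X in _ + X]exchange_big -big_split big1 //= => i _.
rewrite -big_split big1 //= => k _; rewrite -scalerDl -rmorphD /=.
rewrite liebC -scaleN1r -[-1 *: _]addr0 reform_linear reform_inv.
rewrite (reform_sym (lieb x (e k))) [reform 0 _]reform_sym.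
by rewrite (invform0r reform_linear reform_sym) addr0 mulN1r addNr scale0r.
Qed.

Definition casimir : 'End(V) := \sum_(i < \dim N) (sigma (b i) \o sigma (e i))%VF.

Lemma casimirE v : casimir v = \sum_(i < \dim N) sigma (b i) (sigma (e i) v).
Proof. by rewrite sum_lfunE; apply: eq_bigr => i _; rewrite comp_lfunE. Qed.

(** The cocycle c becomes a coboundary after applying the Casimir operator.  For
    the coboundaries c y = sigma y v this says that the operator commutes with
    sigma. *)
Lemma casimir_cocycle (c : g -> V) x :
    (forall a x y, c (a *: x + y) = a%:C%C *: c x + c y) ->
    (forall x y, c (lieb x y) = sigma x (c y) - sigma y (c x)) ->
  sigma x (\sum_(i < \dim N) sigma (b i) (c (e i))) = casimir (c x).
Proof.
move=> cD cL; rewrite casimirE linear_sum /=.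
have [Tl Tr] :
    (forall a x y z, sigma (a *: x + y) (c z)
       = a%:C%C *: sigma x (c z) + sigma y (c z)) /\
    (forall a x y z, sigma z (c (a *: x + y))
       = a%:C%C *: sigma z (c x) + sigma z (c y)).
  by split=> a u v w; rewrite ?sigma_rep.1 ?add_lfunE ?scale_lfunE // cD linearP.
apply/eqP; rewrite -subr_eq0 -sumrB; apply/eqP.
rewrite -[RHS](casimir_invariance (T := fun u v => sigma u (c v)) x Tl Tr).
apply: eq_bigr => i _; rewrite rep_lieb cL linearB /=.
by rewrite addrA subrK.
Qed.

Lemma casimir_commutes x v : sigma x (casimir v) = casimir (sigma x v).
Proof.
rewrite casimirE; apply: (casimir_cocycle (c := fun y => sigma y v)) => [a y z|y z].
  by rewrite sigma_rep.1 add_lfunE scale_lfunE.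
exact: rep_lieb.
Qed.

Lemma Re_trace_casimir : complex.Re (ltrace casimir) = (\dim N)%:R.
Proof.
rewrite /casimir ltrace_sum.
have ReD : {morph @complex.Re R : u v / u + v} by move=> [? ?] [? ?].
rewrite (big_morph _ ReD (erefl _)) -[X in _ = X%:R]card_ord -sum1_card natr_sum.
apply: eq_bigr => i _.
by have := e_dual i i; rewrite reform_sym eqxx.
Qed.

End Casimir.

End RealTraceForm.

End ComplexRepresentations.

(** * Vanishing of the first cohomology *)

Section Fitting.
Variables (F : fieldType) (V : vectType F) (f : 'End(V)).

Lemma iter_lfun_exists k : exists p : 'End(V), forall v, p v = iter k f v.
Proof.
elim: k => [|k [p hp]]; first by exists \1%VF => v; rewrite id_lfunE.
by exists (f \o p)%VF => v; rewrite comp_lfunE hp.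
Qed.

(** Take n for which the image of f^n has the smallest dimension: the images, and
    therefore the kernels, of the powers of f are constant from n on. *)
Lemma fitting : exists n, (forall v, exists w, iter n f v = iter (n + n.+1) f w) /\
  (forall k v, iter (n + k) f v = 0 -> iter n f v = 0).
Proof.
have /boolp.choice[p hp] := iter_lfun_exists.
have exd : exists d, `[< exists n, \dim (limg (p n)) = d >].
  by exists (\dim (limg (p 0%N))); apply/asboolP; exists 0%N.
case: (ex_minnP exd) => d /asboolP[n dn] mind.
have img k : limg (p (n + k)%N) = limg (p n).
  apply/eqP; rewrite eqEdim; apply/andP; split.
    apply/subvP => _ /memv_imgP[v _ ->]; rewrite hp iterD -hp.
    by apply: memv_img; apply: memvf.
  by rewrite dn; apply: mind; apply/asboolP; exists (n + k)%N.
exists n; split=> [v|k v].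
  have : p n v \in limg (p (n + n.+1)%N) by rewrite img memv_img ?memvf.
  by move=> /memv_imgP[w _]; rewrite !hp; exists w.
have ker : lker (p n) = lker (p (n + k)%N).
  apply/eqP; rewrite eqEdim; apply/andP; split.
    apply/subvP => u; rewrite !memv_ker !hp addnC iterD => /eqP ->.
    by rewrite -hp linear0.
  have := limg_ker_dim (p n) fullv; rewrite -(limg_ker_dim (p (n + k)%N) fullv) img.
  by rewrite !capfv => /addIn ->.
by rewrite -!hp => v0; apply/eqP; rewrite -memv_ker ker memv_ker v0.
Qed.

End Fitting.

Section Cohomology.
Variables (R : realType) (g : lieAlgType R).
Hypothesis ss : lie_semisimple g.
Local Notation C := (R[i]).
Implicit Types (x y z : g).

Definition cocycle (V : vectType C) (sigma : g -> 'End(V)) (c : g -> V) : Prop :=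
  (forall a x y, c (a *: x + y) = a%:C%C *: c x + c y) /\
  (forall x y, c (lieb x y) = sigma x (c y) - sigma y (c x)).

Definition stable (V : vectType C) (sigma : g -> 'End(V)) (U : {vspace V}) : Prop :=
  forall x v, v \in U -> sigma x v \in U.

Lemma cocycle_sub_coboundary (V : vectType C) (sigma : g -> 'End(V)) c m :
  is_rep sigma -> cocycle sigma c -> cocycle sigma (fun x => c x - sigma x m).
Proof.
move=> rep [cD cL]; split=> [a x y|x y].
  rewrite cD rep.1 add_lfunE scale_lfunE opprD addrACA.
  by rewrite -scalerBr.
rewrite cL (rep_lieb rep) [sigma x (_ - _)]linearB [sigma y (_ - _)]linearB /=.
by rewrite !opprD !opprK addrACA.
Qed.

(** On K = [K, K] the cocycle identity reads c [u, v] = 0. *)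
Lemma cocycle_ker (V : vectType C) (sigma : g -> 'End(V)) c (K : {vspace g}) :
    is_rep sigma -> cocycle sigma c -> lie_ideal K ->
    (forall x, x \in K -> sigma x = 0) -> forall x, x \in K -> c x = 0.
Proof.
move=> rep [cD cL] idK K0; rewrite -{1}(ideal_perfect ss idK).
have c0 : c 0 = 0.
  by have := cD (-1) 0 0; rewrite scaler0 addr0 rmorphN1 scaleN1r => ->; rewrite addNr.
apply: (@span_ind _ _ (fun x => c x = 0)) => // [a u v u0 v0|].
  by rewrite cD u0 v0 scaler0 addr0.
move=> _ /allpairsP[[u v] /= [uK vK ->]].
by rewrite cL !K0 ?vbasis_mem // !lfunE subr0.
Qed.

(** Let N be the Killing orthogonal of the kernel K of sigma, Om the Casimir
    operator of N, m a vector such that sigma x m = Om (c x) for all x, and n a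
    Fitting exponent of Om.  Writing m = a + Om b with Om^n a = 0, the cocycle
    c x - sigma x b is killed by Om^(n+1), hence by Om^n.  The kernel of Om^n is
    proper because the trace of Om is not zero.  If N = 0 then K is all of g, and
    c vanishes on K. *)
Lemma cocycle_reduction (V : vectType C) (sigma : g -> 'End(V)) c :
    is_rep sigma -> cocycle sigma c ->
  exists m, (forall x, c x = sigma x m) \/
    exists U, [/\ stable sigma U, U != fullv & forall x, c x - sigma x m \in U].
Proof.
move=> rep cc; have [K idK hK] := rep_ker rep.
pose N := orth (@killing R g) K.
have idN : lie_ideal N.
  exact: (orth_ideal (@killing_linear R g) (@killing_sym R g) (@killing_inv R g)).
have N_nondeg := reform_nondegenerate ss rep idK hK.
have [e [eN e_dual]] := dual_basis_exists (reform_linear rep) (reform_sym sigma) N_nondeg.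
pose m := \sum_(i < \dim N) sigma (vbasis N)`_i (c (e i)).
pose Om := casimir sigma e.
have mE x : sigma x m = Om (c x).
  by apply: (casimir_cocycle rep idN N_nondeg eN e_dual); case: cc.
have OmC x v k : sigma x (iter k Om v) = iter k Om (sigma x v).
  elim: k => //= k <-.
  exact: (casimir_commutes rep idN N_nondeg eN e_dual).
have [N0|N0] := eqVneq N 0%VS.
  exists 0; left => x; rewrite linear0.
  apply: (cocycle_ker rep cc idK) => [y|]; first by move/hK.
  by have := memvf x; rewrite -(ideal_add_orth ss idK) -/N N0 addv0.
have [n [img ker]] := fitting Om.
have [w mw] := img m.
(* Here a = m - Om^(n+1) w and b = Om^n w. *)
exists (iter n Om w); right.
have [p hp] := iter_lfun_exists Om n.
exists (lker p); split.
- by move=> x v; rewrite !memv_ker !hp -OmC => /eqP->; rewrite linear0.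
- apply/eqP => pf; have := Re_trace_casimir e_dual.
  rewrite -/Om (@ltrace_nilpotent _ _ _ n) => [/esym/eqP|v].
    by rewrite pnatr_eq0 dimv_eq0 (negPf N0).
  by rewrite -hp; apply/eqP; rewrite -memv_ker pf memvf.
move=> x; rewrite memv_ker hp; apply/eqP.
apply: (ker 1%N); rewrite iterD.
have iter_lin k u v : iter k Om (u - v) = iter k Om u - iter k Om v.
  by elim: k => //= k ->; rewrite linearB.
have -> : iter 1 Om (c x - sigma x (iter n Om w)) = sigma x (m - Om (iter n Om w)).
  rewrite [iter 1 _ _]linearB [sigma x (_ - _)]linearB /= -mE; congr (_ - _).
  exact: esym (OmC _ _ 1%N).
by rewrite -OmC iter_lin mw iterD /= subrr linear0.
Qed.

Lemma restricted_rep (V : vectType C) (sigma : g -> 'End(V)) U :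
    is_rep sigma -> stable sigma U ->
  exists tau : g -> 'End(subvs_of U), is_rep tau /\
    forall x u, vsval (tau x u) = sigma x (vsval u).
Proof.
move=> rep stU.
pose tau x : 'End(subvs_of U) := linfun (vsproj U \o (sigma x \o vsval)).
have tauE x u : vsval (tau x u) = sigma x (vsval u).
  by rewrite lfunE /= vsprojK // stU // subvsP.
exists tau; split=> //; split=> [a x y|x y]; apply/lfunP => u; apply: val_inj.
  by rewrite /= tauE rep.1 !add_lfunE !scale_lfunE linearP /= !tauE.
by rewrite /= tauE (rep_lieb rep) add_lfunE opp_lfunE !comp_lfunE linearB /= !tauE.
Qed.

(** Whitehead's first lemma, by induction on the dimension of U.  The reduction
    passes to a subrepresentation, so quotients never occur. *)
Lemma cocycle_is_coboundary (V : vectType C) (sigma : g -> 'End(V)) c U :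
    is_rep sigma -> cocycle sigma c -> stable sigma U -> (forall x, c x \in U) ->
  exists2 m, m \in U & forall x, c x = sigma x m.
Proof.
move=> rep; move: {2}(\dim U).+1 (ltnSn (\dim U)) => d.
elim: d U c => // d IH U c; rewrite ltnS => dU cc stU cU.
have [tau [rept tauE]] := restricted_rep rep stU.
have cct : cocycle tau (fun x => vsproj U (c x)).
  case: cc => cD cL; split=> [a x y|x y]; first by rewrite cD linearP.
  by rewrite cL linearB; congr (_ - _); apply: val_inj; rewrite /= tauE !vsprojK // stU.
have [m [mE|[W [stW nW Wc]]]] := cocycle_reduction rept cct.
  exists (vsval m); first exact: subvsP.
  by move=> x; rewrite -tauE -mE vsprojK.
pose inj := linfun (vsval : subvs_of U -> V).
have stW' : stable sigma (inj @: W)%VS.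
  move=> x _ /memv_imgP[w wW ->]; rewrite lfunE /= -tauE -[vsval _]lfunE.
  by apply: memv_img; apply: stW.
have dW : (\dim (inj @: W) < d)%N.
  apply: leq_trans dU; rewrite (@leq_ltn_trans (\dim W)) //.
    by rewrite -(limg_ker_dim inj W) leq_addl.
  have -> : \dim U = \dim {:subvs_of U} by rewrite dimvf.
  rewrite (ltn_leqif (dimv_leqif_sup (subvf W))).
  by apply: contra nW => fW; rewrite eqEsubv subvf.
have cW x : c x - sigma x (vsval m) \in (inj @: W)%VS.
  have -> : c x - sigma x (vsval m) = inj (vsproj U (c x) - tau x m).
    by rewrite lfunE linearB /= tauE vsprojK.
  by apply: memv_img.
have [m' m'W m'E] := IH _ _ dW (cocycle_sub_coboundary (vsval m) rep cc) stW' cW.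
exists (vsval m + m').
  rewrite memvD ?subvsP //; have /memv_imgP[w _ ->] := m'W.
  by rewrite lfunE subvsP.
by move=> x; rewrite linearD /= -m'E addrC subrK.
Qed.

End Cohomology.

(** * Complete reducibility *)

Fact commutator_jacobi (Z : zmodType) (a b c d e f : Z) :
  a - b - (c - d) = a - e - (f - d) - (b - f - (e - c)).
Proof.
rewrite !(opprB _ d) !(opprB _ c) !(addrACA _ (- _)) -!opprD [f + e]addrC opprB.
by rewrite addrA subrK.
Qed.

Section CompleteReducibility.
Variables (R : realType) (g : lieAlgType R).
Hypothesis ss : lie_semisimple g.
Local Notation C := (R[i]).
Implicit Types (x y z : g).

Section EndomorphismModule.
Variables (V : vectType C) (sigma : g -> 'End(V)).
Hypothesis rep : is_rep sigma.

Fact end_action_fact x : linear (fun f => (sigma x \o f)%VF - (f \o sigma x)%VF).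
Proof.
move=> a f h; rewrite comp_lfunDr comp_lfunDl -comp_lfunZr -comp_lfunZl.
by rewrite scalerBr opprD addrACA.
Qed.

Definition commutator x (f : 'End(V)) := (sigma x \o f)%VF - (f \o sigma x)%VF.
HB.instance Definition _ x :=
  GRing.isLinear.Build C 'End(V) 'End(V) _ (commutator x) (end_action_fact x).

Definition end_rep x : 'End('End(V)) := linfun (commutator x).

Lemma end_repE x f v : end_rep x f v = sigma x (f v) - f (sigma x v).
Proof. by rewrite lfunE /= add_lfunE opp_lfunE !comp_lfunE. Qed.

Lemma end_rep_is_rep : is_rep end_rep.
Proof.
split=> [a x y|x y]; apply/lfunP => f; apply/lfunP => v.
  rewrite !(add_lfunE, scale_lfunE) !end_repE rep.1 !(add_lfunE, scale_lfunE) linearP /=.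
  by rewrite scalerBr opprD addrACA.
rewrite !(add_lfunE, opp_lfunE, comp_lfunE) !end_repE !(rep_lieb rep).
rewrite [f (_ - _)]linearB [sigma x (_ - _)]linearB [sigma y (_ - _)]linearB /=.
exact: commutator_jacobi.
Qed.

(** Let p0 be a linear projection onto U.  The commutators [sigma x, p0] form a
    cocycle with values in the module of maps f : V -> U that vanish on U.  Hence
    they equal [sigma x, m] for such an m, and p0 - m is still a projection onto U
    and commutes with sigma. *)
Lemma equivariant_projection (U : {vspace V}) : stable sigma U ->
  exists p : 'End(V), [/\ forall v, p v \in U, forall u, u \in U -> p u = u
    & forall x v, p (sigma x v) = sigma x (p v)].
Proof.
move=> stU.
have [B hB] : exists B : {vspace 'End(V)}, forall f, f \in B <->
    (forall v, f v \in U) /\ forall u, u \in U -> f u = 0.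
  apply: vspace_of_pred => [|a f h [fU f0] [hU h0]].
    by split=> [v|u _]; rewrite lfunE ?mem0v.
  split=> [v|u uU]; first by rewrite add_lfunE scale_lfunE memvD ?memvZ.
  by rewrite add_lfunE scale_lfunE f0 // h0 // scaler0 addr0.
have repE := end_rep_is_rep.
have [||x|m mB mE] := @cocycle_is_coboundary R g ss _ end_rep
    (fun x => end_rep x (projv U)) B repE.
- split=> [a x y|x y]; last exact: rep_lieb.
  by rewrite repE.1 add_lfunE scale_lfunE.
- move=> x f /hB[fU f0]; apply/hB; split=> [v|u uU]; rewrite end_repE.
    by rewrite memvB // stU.
  by rewrite !f0 ?stU // linear0 subrr.
- apply/hB; split=> [v|u uU]; rewrite end_repE.
    by rewrite memvB ?memv_proj // stU ?memv_proj.
  by rewrite !projv_id ?stU // subrr.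
have [mU m0] := (hB m).1 mB.
exists (projv U - m); split=> [v|u uU|x v]; rewrite !(add_lfunE, opp_lfunE).
- by rewrite memvB ?memv_proj.
- by rewrite projv_id // m0 // subr0.
have := mE x => /lfunP/(_ v); rewrite !end_repE => /eqP.
rewrite [sigma x (_ - _)]linearB /= subr_eq => /eqP ->.
by rewrite addrAC [X in _ = X + _]addrAC subrr add0r addrC.
Qed.

End EndomorphismModule.

Section Quaternionic.
Variables (V : vectType C) (r : hrep g V).
Implicit Types (U W : {vspace V}).
Local Notation J := (hrep_J r).
Local Notation rho := (hrep_rho r).

Lemma hrep_is_rep : is_rep rho.
Proof. by split=> [a x y|x y]; [rewrite linearP | rewrite hrep_lieb]. Qed.

(** If p is an equivariant projection onto U, then so is q = (p - J p J) / 2, and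
    moreover q commutes with J since J^2 = -1.  The complement is the kernel of
    q. *)
Lemma hrep_complement U : subhrep r U ->
  exists W, [/\ subhrep r W, (U :&: W = 0)%VS & (U + W = fullv)%VS].
Proof.
move=> [rhoU JU].
have [p [pU p_id pE]] := equivariant_projection hrep_is_rep rhoU.
have JJ := hrep_JJ r; have Jrho := hrep_equiv r.
pose q v := 2^-1 *: (p v - J (p (J v))).
have qP a u v : q (a *: u + v) = a *: q u + q v.
  rewrite /q; have -> : J (p (J (a *: u + v))) = a *: J (p (J u)) + J (p (J v)).
    by rewrite 3!linearP /= conjCK.
  rewrite [p (_ + _)]linearP /= opprD addrACA -scalerBr scalerDr.
  by rewrite !scalerA mulrC.
have q_id u : u \in U -> q u = u.
  move=> uU; rewrite /q p_id // p_id ?JU // JJ opprK -mulr2n -[u *+ 2]scaler_nat scalerA.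
  by rewrite mulVf ?scale1r // pnatr_eq0.
have qU v : q v \in U by rewrite /q; apply/memvZ/memvB; [apply: pU | apply/JU/pU].
have [W hW] : exists W, forall v, v \in W <-> q v = 0.
  apply: vspace_of_pred => [|a u v u0 v0]; last by rewrite qP u0 v0 scaler0 addr0.
  by apply: q_id; rewrite mem0v.
exists W; split.
- split=> [x v /hW v0|v /hW v0]; apply/hW.
    rewrite /q Jrho !pE Jrho -linearB -linearZ /= -/(q v).
    by rewrite v0 linear0.
  have -> : q (J v) = J (q v).
    rewrite /q [J (_ *: _)]linearZ [J (_ - _)]linearB /= fmorphV rmorph_nat !JJ.
    by rewrite [p (- _)]linearN [J (- _)]linearN /= !opprK addrC.
  by rewrite v0 linear0.
- apply/eqP; rewrite -subv0; apply/subvP => v; rewrite memv_cap memv0.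
  by move=> /andP[vU /hW]; rewrite q_id // => ->.
apply/eqP; rewrite eqEsubv subvf; apply/subvP => v _.
apply/memv_addP; exists (q v) => //; exists (v - q v); last by rewrite addrC subrK.
by apply/hW; rewrite addrC -scaleN1r qP q_id // scaleN1r addNr.
Qed.

(** Irreducibility phrased inside V, so that it does not depend on a proof that U
    is invariant. *)
Definition minimal_subhrep U := [/\ subhrep r U, U != 0%VS &
  forall W, subhrep r W -> (W <= U)%VS -> W = 0%VS \/ W = U].

Lemma minimal_subhrep_irreducible U (subU : subhrep r U) :
  minimal_subhrep U -> hrep_irreducible (hrep_res subU).
Proof.
move=> [_ U0 minU]; split.
  by rewrite -dimv_eq0 dimvf dimv_eq0.
move=> S [rhoS JS]; pose inj := linfun (vsval : subvs_of U -> V).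
have dS : \dim (inj @: S) = \dim S.
  rewrite limg_dim_eq //; apply/eqP; rewrite -subv0; apply/subvP => s.
  rewrite memv_cap memv_ker lfunE memv0 => /andP[_ /= /eqP s0].
  by apply/eqP/val_inj; rewrite /= s0.
have sSU : (inj @: S <= U)%VS.
  by apply/subvP => _ /memv_imgP[s _ ->]; rewrite lfunE subvsP.
have subS : subhrep r (inj @: S)%VS.
  split=> [x _ /memv_imgP[s sS ->]|_ /memv_imgP[s sS ->]]; rewrite lfunE /=.
    rewrite -(val_res_rho subU) -[vsval _]lfunE; apply: memv_img.
    exact: (rhoS x).
  rewrite -(val_res_J subU) -[vsval _]lfunE; apply: memv_img.
  exact: JS.
have [S0|SU] := minU _ subS sSU.
  by left; apply/eqP; rewrite -dimv_eq0 -dS S0 dimv0.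
by right; apply/eqP; rewrite eqEdim subvf /= -dS SU dimvf.
Qed.

(** Split off a nonzero invariant subspace of smallest dimension.  The equality of
    dimensions records that the sum is direct. *)
Lemma subhrep_decomposition U : subhrep r U -> exists ws : seq {vspace V},
  [/\ forall W, W \in ws -> minimal_subhrep W,
      (\sum_(W <- ws) W)%VS = U & (\sum_(W <- ws) \dim W)%N = \dim U].
Proof.
move: {2}(\dim U).+1 (ltnSn (\dim U)) => d.
elim: d U => // d IH U; rewrite ltnS => dU subU.
have [->|U0] := eqVneq U 0%VS.
  by exists [::]; rewrite !big_nil dimv0.
pose Q n := `[< exists W, [/\ \dim W = n, subhrep r W, W != 0%VS & (W <= U)%VS] >].
have exQ : exists n, Q n by exists (\dim U); apply/asboolP; exists U.
case: (ex_minnP exQ) => n /asboolP[W [dW subW W0 WU]] minW.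
have irrW : minimal_subhrep W.
  split=> // S subS SW; have [->|S0] := eqVneq S 0%VS; [by left|right].
  apply/eqP; rewrite eqEdim SW dW; apply: minW; apply/asboolP; exists S.
  by split=> //; apply: subv_trans WU.
have [W' [subW' cap0 addf]] := hrep_complement subW.
have cap0' : (W :&: (U :&: W') = 0)%VS.
  by apply/eqP; rewrite -subv0 -cap0 capvS // capvSr.
have defU : (W + (U :&: W'))%VS = U.
  apply/eqP; rewrite eqEsubv subv_add WU capvSl; apply/subvP => u uU.
  have := memvf u; rewrite -addf => /memv_addP[a aW [b bW' uab]].
  apply/memv_addP; exists a => //; exists b => //.
  rewrite memv_cap bW' andbT; have -> : b = u - a by rewrite uab addrAC subrr add0r.
  by rewrite memvB // (subvP WU).
have dimU : \dim U = (\dim W + \dim (U :&: W')%VS)%N.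
  by rewrite -{1}defU dimv_disjoint_sum.
have [||ws [irr sumws dimws]] := IH (U :&: W')%VS.
- rewrite (leq_trans _ dU) // dimU -[X in (X < _)%N]add0n ltn_add2r lt0n dimv_eq0.
  exact: W0.
- split=> [x v|v]; rewrite !memv_cap => /andP[vU vW'].
    by rewrite subU.1 // subW'.1.
  by rewrite subU.2 // subW'.2.
exists (W :: ws); split=> [S||]; last 2 first.
- by rewrite big_cons sumws defU.
- by rewrite big_cons dimws dimU.
by rewrite inE => /predU1P[->|/irr].
Qed.

End Quaternionic.
End CompleteReducibility.

Theorem theorem4p15 (R : realType) (g : lieAlgType R)
    (gss : lie_semisimple g) (V : vectType (complex R)) (r : hrep g V) :
  exists (n : nat) (W : 'I_n -> {vspace V})
         (subW : forall i : 'I_n, subhrep r (W i)),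
    directv (\sum_(i < n) W i) /\
    (\sum_(i < n) W i)%VS = fullv /\
    forall i : 'I_n, hrep_irreducible (hrep_res (subW i)).
Proof.
have [|ws [irr sumws dimws]] := @subhrep_decomposition R g gss V r fullv.
  by split=> *; rewrite memvf.
pose W (i : 'I_(size ws)) := tnth (in_tuple ws) i.
have irrW i : minimal_subhrep r (W i) by apply/irr/mem_tnth.
have subW i : subhrep r (W i) by case: (irrW i).
exists (size ws), W, subW.
have sumW : (\sum_(i < size ws) W i)%VS = fullv by rewrite -sumws [RHS]big_tnth.
split; last by split=> // i; apply: minimal_subhrep_irreducible.
by rewrite directvE /= sumW -dimws [X in X == _]big_tnth.
Qed.
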